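(* Let $n\ge 1$ be a fixed integer, and let $S_n(H)$ denote the number of $n\times n$ stochastic matrices all of whose entries are rational numbers of height at most $H$. Then, as $H\to\infty$, $$H^{n^2} \ll S_n(H) \le H^{n^2}(\log H)^{n(2^n-1)+o(1)}.$$
   Context: A stochastic matrix is a square matrix $A=(\alpha_{i,j})_{i,j=1}^n$ with nonnegative entries such that $\sum_{j=1}^n\alpha_{i,j}=1$ for each $i=1,\ldots,n$. The height of a rational number $\alpha$ is $\mathrm{h}(\alpha)=\max\{|s|,r\}$, where the integers $r,s$ are uniquely defined by $\alpha=s/r$, $\gcd(r,s)=1$, $r\ge 1$. Thus $S_n(H)$ counts stochastic $n\times n$ matrices with entries in $\mathcal{F}(H)=\{\alpha\in\mathbb{Q} : \alpha\ge 0,\ \mathrm{h}(\alpha)\le H\}$. The notation $U\ll V$ means $|U|\le cV$ for some constant $c>0$, which here may depend on $n$; $o(1)$ denotes a quantity tending to $0$ as $H\to\infty$ for fixed $n$.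
   Formalization: The lower bound is stated only for n ≥ 2, since for n = 1 the only stochastic matrix is (1), so S_1(H) = 1 and H ≪ S_1(H) fails; the upper bound is kept for all n ≥ 1. *)

(* Defs.v *)
From HB Require Import structures.
From mathcomp Require Import all_boot all_order all_algebra finmap.
From mathcomp Require Import boolp classical_sets cardinality.

Set Implicit Arguments.
Unset Strict Implicit.
Unset Printing Implicit Defensive.

Import Order.TTheory GRing.Theory Num.Theory.

Local Open Scope classical_set_scope.
Local Open Scope ring_scope.

Definition stochastic (K : numDomainType) (n : nat) (A : 'M[K]_n) : Prop :=
  (forall i j, 0 <= A i j) /\ (forall i, \sum_j A i j = 1).

(* [numq] and [denq] are the coprime numerator and positive denominator, so
   0 = 0/1 has height 1. *)
Definition height (a : rat) : nat := maxn `|numq a|%N `|denq a|%N.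

Definition stochastic_ht (R : numDomainType) (n : nat) (H : R) :
    set 'M[rat]_n :=
  [set A | stochastic A /\ forall i j, (height (A i j))%:R <= H].
Arguments stochastic_ht {R} n H.

(* [fset_set] is the empty set on infinite sets; [stochastic_ht_finite] shows
   that this default value is never used when [R] is archimedean. *)
Definition count_stochastic (R : numDomainType) (n : nat) (H : R) : nat :=
  #|` fset_set (stochastic_ht n H)|%fset.

Lemma stochastic_ht_finite (R : archiRealDomainType) (n : nat) (H : R) :
  finite_set (stochastic_ht n H).
Proof.
pose N := Num.bound H.
pose q (p : bool * 'I_N.+1 * 'I_N.+1) : rat :=
  (-1) ^+ p.1.1 * p.1.2%:R / p.2%:R.
pose F (f : {ffun 'I_n * 'I_n -> bool * 'I_N.+1 * 'I_N.+1}) : 'M[rat]_n :=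
  \matrix_(i, j) q (f (i, j)).
apply: (@sub_finite_set _ _ (F @` setT)); last first.
  by apply: finite_image; exact: finite_finset.
move=> A [_ hA].
have hN i j : (height (A i j) <= N)%N.
  have H0 : 0 <= H by apply: le_trans (hA i j); rewrite ler0n.
  have := le_lt_trans (hA i j) (archi_boundP H0).
  by rewrite ltr_nat => /ltnW.
exists [ffun p => (numq (A p.1 p.2) < 0, inord `|numq (A p.1 p.2)|%N,
                   inord `|denq (A p.1 p.2)|%N)] => //.
apply/matrixP => i j; rewrite !mxE ffunE /q /=.
have := hN i j; rewrite /height geq_max => /andP[h1 h2].
rewrite !inordK // -[RHS]divq_num_den; congr (_ / _).
  rewrite [X in _ = X%:~R]intEsign rmorphM /= rmorphXn /= rmorphN1.
  by rewrite pmulrn.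
by rewrite pmulrn absz_denq.
Qed.

(* In dimension 1 the count does not grow: the identity is the only stochastic
   matrix. A lower bound of order H ^+ (n ^ 2) can hold only for n >= 2. *)
Lemma count_stochastic1 (R : numDomainType) (H : R) :
  1 <= H -> count_stochastic 1 H = 1%N.
Proof.
move=> H1; rewrite /count_stochastic.
suff -> : stochastic_ht 1 H = [set 1%:M] by rewrite fset_set1 cardfs1.
apply/seteqP; split => A /=.
  move=> [[_ h] _]; apply/matrixP => i j.
  by have := h 0; rewrite big_ord1 !ord1 mxE eqxx.
move=> ->; split; [split|] => i; last by move=> j; rewrite !ord1 mxE eqxx.
- by move=> j; rewrite !ord1 mxE eqxx.
- by rewrite big_ord1 !ord1 mxE eqxx.
Qed.

(* Main.v *)
Require Import Defs.
From mathcomp Require Import all_boot all_order all_algebra finmap.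
From mathcomp Require Import all_classical all_reals all_analysis.
From mathcomp Require Import zify ring lra.

Import Order.TTheory GRing.Theory Num.Theory numFieldNormedType.Exports.

(** The rows of a stochastic matrix are chosen independently, so the count is
    [V ^ n], where [V] is the number of nonnegative rational vectors of length
    [n] with sum 1 and entries of height at most [N], the integer part of [H].
    It remains to show [V >> N ^ n] and [V << N ^ n (ln N) ^ (2 ^ n - 1)].

    Upper bound. Fix the denominators [r_1, ..., r_n]. The numerators lie in
    [0, N], and a solution of [sum s_i / r_i = 1] is in particular a solution
    modulo 1. Choosing the numerators one after the other, [s_i] is confined to
    a residue class, and the moduli multiply up to the least common multiple of
    the [r_i]: there are at most [(2 N) ^ n / lcm (r_1, ..., r_n)] solutions
    ([count_frac_sum]).

    It remains to sum [1 / lcm] over all denominators. By repeatedly splitting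
    off greatest common divisors, a tuple [r] is encoded by [2 ^ n - 1] positive
    integers [d_S], one for each nonempty set [S] of indices, such that [r_i] is
    the product of the [d_S] with [i] in [S], and the least common multiple is
    the product of all the [d_S]. Since every [d_S] divides some [r_i], it is at
    most [N], whence
    [sum_r 1 / lcm r <= (sum_(d <= N) 1 / d) ^ (2 ^ n - 1)]
    ([sum_lcms_prods], [sum_prods_inv]), and the harmonic sum is at most
    [1 + ln N]. The multiplicative constant is absorbed in the exponent of
    [ln H], as a power [ln C / ln (ln H)], which tends to 0.

    Lower bound. A vector [s] of positive integers [<= N / n] with greatest
    common divisor 1 is determined by its normalization [s / sum s], which is a
    vector counted by [V]. Removing from the cube [[1, M] ^ n] the vectors
    divisible by some [d >= 2] leaves at least a quarter of it, because
    [sum_(d >= 2) 1 / d ^ n <= 3 / 4] for [n >= 2] ([count_primitive]). *)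

Set Implicit Arguments.
Unset Strict Implicit.
Unset Printing Implicit Defensive.

Local Open Scope classical_set_scope.
Local Open Scope ring_scope.

(** * Words over a finite alphabet *)

Fixpoint words (T : Type) (s : seq T) (n : nat) : seq (seq T) :=
  if n is m.+1 then [seq x :: w | x <- s, w <- words s m] else [:: [::]].

Lemma size_words (T : Type) (s : seq T) n : size (words s n) = (size s ^ n)%N.
Proof. by elim: n => //= n IHn; rewrite size_allpairs IHn expnS. Qed.

Lemma mem_words (T : eqType) (s : seq T) n w :
  (w \in words s n) = (size w == n) && all (fun x => x \in s) w.
Proof.
elim: n w => [|n IHn] [|x w] //=; first by apply/allpairsP; case=> -[? ?] [].
rewrite eqSS andbCA; apply/allpairsP/andP => [[[y v] /= [ys vw [-> ->]]]|[xs]].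
  by rewrite ys -IHn.
by rewrite -IHn => wn; exists (x, w).
Qed.

Lemma uniq_words (T : eqType) (s : seq T) n : uniq s -> uniq (words s n).
Proof.
move=> us; elim: n => [//|n IHn] /=.
by apply: allpairs_uniq => // -[x v] [y w] _ _ /= [-> ->].
Qed.

Lemma big_words (V : nmodType) (T : Type) (s : seq T) n (F : seq T -> V) :
  \sum_(w <- words s n.+1) F w = \sum_(x <- s) \sum_(w <- words s n) F (x :: w).
Proof. exact: big_allpairs_dep. Qed.

Lemma count_words (T : Type) (s : seq T) n (P : pred (seq T)) :
  count P (words s n.+1) =
    (\sum_(x <- s) count (fun w => P (x :: w)) (words s n))%N.
Proof.
rewrite -sum1_count big_mkcond big_allpairs_dep; apply: eq_bigr => x _.
by rewrite -sum1_count [RHS]big_mkcond.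
Qed.

Lemma count_all_words (T : Type) (s : seq T) n (p : pred T) :
  count (all p) (words s n) = (count p s ^ n)%N.
Proof.
elim: n => [//|n IHn]; rewrite count_words expnS -IHn -sum1_count big_distrl /=.
rewrite [RHS]big_mkcond; apply: eq_bigr => x _; case: (p x) => /=.
  by rewrite mul1n.
by rewrite count_pred0.
Qed.

(** * Solutions of a linear congruence with fixed denominators *)

(** Division by [m] is injective on a residue class, so there are at most
    [N %/ m + 1] elements; as [m <= N], this is at most [2 N / m]. *)
Lemma count_residue_class (P : pred nat) m N :
  (0 < m <= N)%N -> (forall s t, P s -> P t -> s = t %[mod m]) ->
  (count P (iota 0 N.+1) * m <= 2 * N)%N.
Proof.
move=> /andP[m0 mN] Pm.
have : (count P (iota 0 N.+1) <= (N %/ m).+1)%N.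
  rewrite -size_filter -(size_map (divn^~ m)) -[leqRHS](size_iota 0).
  apply: uniq_leq_size => [|q].
    rewrite map_inj_in_uniq ?filter_uniq ?iota_uniq // => s t.
    rewrite !mem_filter => /andP[Ps _] /andP[Pt _] eqst.
    by rewrite (divn_eq s m) (divn_eq t m) eqst (Pm s t).
  case/mapP => s; rewrite mem_filter !mem_iota /= !add0n !ltnS => /andP[_ sN] ->.
  exact: leq_div2r.
rewrite -(leq_pmul2r m0) => /leq_trans; apply.
have := leq_divM N m; lia.
Qed.

Definition frac_sum (rs ss : seq nat) : rat :=
  \sum_(p <- zip rs ss) p.2%:R / p.1%:R.

Definition lcms (rs : seq nat) : nat := \big[lcmn/1%N]_(r <- rs) r.

Lemma lcms_cons r rs : lcms (r :: rs) = lcmn r (lcms rs).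
Proof. exact: big_cons. Qed.

Lemma lcms_gt0 rs : all (fun r => 0 < r)%N rs -> (0 < lcms rs)%N.
Proof.
elim: rs => [|r rs IHrs] /=; first by rewrite /lcms big_nil.
by move=> /andP[r0 /IHrs]; rewrite lcms_cons lcmn_gt0 r0.
Qed.

Lemma frac_sum_cons r rs s ss :
  frac_sum (r :: rs) (s :: ss) = s%:R / r%:R + frac_sum rs ss.
Proof. exact: big_cons. Qed.

(** [lcms rs] is a common denominator. *)
Lemma frac_sum_int rs ss L :
  all (fun r => 0 < r)%N rs -> (lcms rs %| L)%N ->
  frac_sum rs ss * L%:R \is a Num.int.
Proof.
elim: rs ss => [|r rs IHrs] [|s ss] /=.
1-3: by rewrite /frac_sum /= big_nil mul0r rpred0.
move=> /andP[r0 rs0]; rewrite lcms_cons dvdn_lcm => /andP[/dvdnP[k Lk] rsL].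
rewrite frac_sum_cons mulrDl rpredD ?IHrs // Lk natrM.
rewrite mulrA mulrAC divfK ?pnatr_eq0 -?lt0n // -natrM; exact: rpred_nat.
Qed.

(** The target [c] is arbitrary so that the induction can pass from [c] to
    [c - s / r]. With [L] the least common multiple of the remaining
    denominators, the congruence has no solution unless [(c - s / r) L] is an
    integer. This confines [s] to one residue class modulo [m := r / gcd r L],
    and [m L] is the new least common multiple. *)
Lemma count_frac_sum rs N (c : rat) :
  all (fun r => 0 < r <= N)%N rs ->
  (count (fun ss => (c - frac_sum rs ss)%R \is a Num.int)
     (words (iota 0 N.+1) (size rs)) * lcms rs <= (2 * N) ^ size rs)%N.
Proof.
elim: rs c => [|r rs IHrs] c.
  by rewrite /lcms big_nil /=; case: (_ \in _).
case/andP=> /andP[r0 rN] rsN.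
have rs0 : all (fun r => 0 < r)%N rs by apply: sub_all rsN => x /andP[].
set L := lcms rs.
pose P s := (c - s%:R / r%:R) * L%:R \is a Num.int.
pose m := (r %/ gcdn r L)%N.
have rm : (r = m * gcdn r L)%N by rewrite divnK // dvdn_gcdl.
have g0 : (0 < gcdn r L)%N by rewrite gcdn_gt0 r0.
have lcmE : lcms (r :: rs) = (m * L)%N.
  apply/eqP; rewrite lcms_cons -/L -(eqn_pmul2r g0) muln_lcm_gcd {1}rm.
  by rewrite mulnAC.
have Pm s t : P s -> P t -> s = t %[mod m].
  rewrite /P => Ps Pt; have := rpredB Pt Ps.
  rewrite -mulrBl opprB addrC addrA subrK -mulrBl mulrAC => /intrP[z Hz].
  (* Divided by gcd r L, this says that m divides s - t, because m is
     coprime to L / gcd r L. *)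
  have : ((s%:Z - t%:Z) * L%:Z = z * r%:Z)%R.
    apply: (@intr_inj rat); rewrite !rmorphM rmorphB /= -!pmulrn.
    by rewrite -Hz divfK // pnatr_eq0 -lt0n.
  have Ll : L = (L %/ gcdn r L * gcdn r L)%N by rewrite divnK // dvdn_gcdr.
  set l := (L %/ _)%N in Ll; have cop : coprimez m l.
    by rewrite /coprimez /gcdz eqz_nat -(eqn_pmul2r g0) muln_gcdl -rm -Ll mul1n.
  have gE : (gcdn r L)%:Z != 0 by rewrite eqz_nat -lt0n.
  move=> Hm; rewrite [in LHS]Ll [in RHS]rm !PoszM !mulrA in Hm.
  move/(mulIf gE): Hm => Hm.
  apply/eqP; rewrite -eqz_nat -!modz_nat eqz_mod_dvd -(Gauss_dvdzl _ cop) Hm.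
  exact: dvdz_mull.
have sumE s : (count (fun ss => (c - frac_sum (r :: rs) (s :: ss))%R \is a Num.int)
     (words (iota 0 N.+1) (size rs)) * L <= P s * (2 * N) ^ size rs)%N.
  have [Ps|nPs] := boolP (P s).
    rewrite mul1n; apply: leq_trans (IHrs (c - s%:R / r%:R) rsN).
    rewrite leq_mul2r; apply/orP; right; apply: sub_count => ss /=.
    by rewrite frac_sum_cons opprD addrA.
  rewrite (@eq_count _ _ pred0) ?count_pred0 // => ss /=.
  apply/negbTE; apply: contra nPs; rewrite frac_sum_cons opprD addrA => H.
  have := rpredD (rpredM H (rpred_nat _ L)) (frac_sum_int ss rs0 (dvdnn L)).
  by rewrite -mulrDl subrK.
rewrite -[size (r :: rs)]/(size rs).+1 count_words lcmE mulnCA.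
rewrite big_distrl /= expnS.
apply: (@leq_trans (m * (count P (iota 0 N.+1) * (2 * N) ^ size rs))).
  rewrite leq_mul2l -sum1_count big_distrl [leqRHS]big_mkcond /=.
  apply/orP; right; apply: leq_sum => s _; apply: leq_trans (sumE s) _.
  by case: (P s) => //; rewrite mul0n.
rewrite mulnA leq_mul2r [X in (X <= _)%N]mulnC count_residue_class ?orbT //.
by rewrite -(ltn_pmul2r g0) -rm r0 /= (leq_trans _ rN) // rm leq_pmulr.
Qed.

(** * Sums over least common multiples *)

Lemma ler_sum_inj (K : numDomainType) (T U : eqType) (s : seq T) (t : seq U)
    (f : T -> U) (F : U -> K) :
  uniq s -> uniq t -> {in s &, injective f} -> {in s, forall x, f x \in t} ->
  (forall y, 0 <= F y) -> \sum_(x <- s) F (f x) <= \sum_(y <- t) F y.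
Proof.
move=> us ut f_inj fst F0; rewrite -(big_map f predT).
have uf : uniq [seq f x | x <- s] by rewrite map_inj_in_uniq.
have fs_t : perm_eq [seq f x | x <- s] [seq y <- t | y \in map f s].
  apply: uniq_perm; rewrite ?filter_uniq // => y; rewrite mem_filter.
  by have [/mapP[x xs ->]|//] := boolP (y \in _); rewrite fst.
by rewrite (perm_big _ fs_t) big_filter big_mkcond; apply: ler_sum => y _; case: ifP.
Qed.

(** A pair [(r, d)] is recovered from its gcd and the two cofactors, all of
    which are again at most [N]. *)
Lemma sum_gcd_split (K : numDomainType) N (F : nat -> nat -> nat -> K) :
  (forall h d r, 0 <= F h d r) ->
  \sum_(r <- iota 1 N) \sum_(d <- iota 1 N)
     F (gcdn r d) (d %/ gcdn r d)%N (r %/ gcdn r d)%N <=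
  \sum_(h <- iota 1 N) \sum_(d <- iota 1 N) \sum_(r <- iota 1 N) F h d r.
Proof.
move=> F0; pose s := iota 1 N.
have mems x : (x \in s) = (0 < x <= N)%N by rewrite mem_iota add1n ltnS.
pose f p := (gcdn p.1 p.2, (p.2 %/ gcdn p.1 p.2, p.1 %/ gcdn p.1 p.2)%N).
rewrite -(big_allpairs_dep (h := pair)
  (F := fun p => F (f p).1 (f p).2.1 (f p).2.2)).
under [leRHS]eq_bigr do
  rewrite -(big_allpairs_dep (h := pair) (F := fun p => F _ p.1 p.2)).
rewrite -(big_allpairs_dep (h := pair) (F := fun p => F p.1 p.2.1 p.2.2)).
have us : uniq s by exact: iota_uniq.
have uss : uniq [seq (x, y) | x <- s, y <- s].
  by apply: allpairs_uniq => // -[? ?] [? ?] _ _ [-> ->].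
apply: (ler_sum_inj (f := f)) => //.
- by apply: allpairs_uniq => // -[? ?] [? ?] _ _ [-> ->].
- move=> [r d] [r' d'] _ _ [eg].
  rewrite -eg => ed er; congr pair.
    by rewrite -(divnK (dvdn_gcdl r d)) er eg divnK ?dvdn_gcdl.
  by rewrite -(divnK (dvdn_gcdr r d)) ed eg divnK ?dvdn_gcdr.
move=> _ /allpairsP[[r d] [/= rs ds ->]].
move: rs ds; rewrite !mems => /andP[r0 rN] /andP[d0 dN].
have g0 : (0 < gcdn r d)%N by rewrite gcdn_gt0 r0.
have gr : (gcdn r d <= r)%N by rewrite dvdn_leq ?dvdn_gcdl.
have gd : (gcdn r d <= d)%N by rewrite dvdn_leq ?dvdn_gcdr.
apply: allpairs_f; [|apply: allpairs_f]; rewrite mems ?g0 ?divn_gt0 ?gr ?gd //=.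
- exact: leq_trans rN.
- exact: leq_trans (leq_div _ _) dN.
- exact: leq_trans (leq_div _ _) rN.
Qed.

Definition prods (ds : seq nat) : nat := \prod_(d <- ds) d.

(** The cofactor of [d] is coprime to that of [r], so it can be taken out of
    the least common multiple. *)
Lemma lcmn_gcd_split r d D : (0 < r)%N ->
  lcmn r (d * D) =
    (gcdn r d * (d %/ gcdn r d) * lcmn (r %/ gcdn r d) D)%N.
Proof.
move=> r0; have g0 : (0 < gcdn r d)%N by rewrite gcdn_gt0 r0.
have [gr gd] : (gcdn r d %| r)%N /\ (gcdn r d %| d)%N.
  by rewrite dvdn_gcdl dvdn_gcdr.
set g := gcdn r d in g0 gr gd *.
have dg : d = (g * (d %/ g))%N by rewrite mulnC divnK.
have rg : r = (g * (r %/ g))%N by rewrite mulnC divnK.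
have cop : coprime (r %/ g) (d %/ g).
  by rewrite /coprime -(eqn_pmul2l g0) muln_gcdr -rg -dg muln1 eqxx.
have r'0 : (0 < r %/ g)%N by rewrite divn_gt0 // dvdn_leq.
have h0 : (0 < gcdn (r %/ g) D)%N by rewrite gcdn_gt0 r'0.
rewrite {1}dg {1}rg -mulnA -muln_lcmr -mulnA; congr muln.
apply/eqP; rewrite -(eqn_pmul2r h0) -{1}(Gauss_gcdr D cop) muln_lcm_gcd.
by rewrite -mulnA muln_lcm_gcd mulnCA.
Qed.

(** Split [r] against the first letter [d] of the word: the gcd and the cofactor
    of [d] are two letters of the new word, and the cofactor of [r] is split
    against the remaining letters. Each letter thus becomes two, and what is
    left of [r] is the last one. Quantifying over [F] lets the letters already
    produced be absorbed in it. *)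
Lemma sum_lcm_prods (K : numDomainType) N k (F : nat -> K) :
  (forall x, 0 <= F x) ->
  \sum_(r <- iota 1 N) \sum_(ds <- words (iota 1 N) k) F (lcmn r (prods ds)) <=
  \sum_(ds <- words (iota 1 N) (2 * k).+1) F (prods ds).
Proof.
elim: k F => [|k IHk] F F0.
  rewrite muln0 big_words; apply: ler_sum => r _.
  by rewrite !big_seq1 /prods big_nil big_seq1 lcmn1.
under eq_bigr do rewrite big_words.
pose G h d r :=
  \sum_(ds <- words (iota 1 N) k) F (h * d * lcmn r (prods ds))%N.
apply: (@le_trans _ _ (\sum_(r <- iota 1 N) \sum_(d <- iota 1 N)
   G (gcdn r d) (d %/ gcdn r d)%N (r %/ gcdn r d)%N)).
  rewrite big_seq [leRHS]big_seq; apply: ler_sum => r.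
  rewrite mem_iota => /andP[r0 _]; apply: ler_sum => d _; apply: ler_sum => ds _.
  by rewrite /prods big_cons lcmn_gcd_split.
apply: le_trans (sum_gcd_split _ _) _ => [h d r|]; first exact: sumr_ge0.
rewrite mulnS !addSn add0n big_words; apply: ler_sum => h _.
rewrite big_words; apply: ler_sum => d _.
apply: le_trans (IHk (fun x => F (h * d * x)%N) _) _ => //.
by apply: ler_sum => ds _; rewrite /prods !big_cons mulnA.
Qed.

(** The letters of [ds] stand for the nonempty sets of indices: a further
    denominator splits each of them into two and adds one of its own, and
    [2 ^ n.+1 - 1 = 2 * (2 ^ n - 1) + 1]. *)
Lemma sum_lcms_prods (K : numDomainType) N n (F : nat -> K) :
  (forall x, 0 <= F x) ->
  \sum_(rs <- words (iota 1 N) n) F (lcms rs) <=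
  \sum_(ds <- words (iota 1 N) (2 ^ n - 1)) F (prods ds).
Proof.
elim: n F => [|n IHn] F F0; first by rewrite !big_seq1 /lcms /prods !big_nil.
have -> : (2 ^ n.+1 - 1 = (2 * (2 ^ n - 1)).+1)%N.
  by have := expn_gt0 2 n; rewrite expnS; lia.
apply: le_trans _ (sum_lcm_prods _ _ F0).
rewrite big_words exchange_big [leRHS]exchange_big /=.
under eq_bigr do under eq_bigr do rewrite lcms_cons.
by apply: (IHn (fun x => \sum_(r <- iota 1 N) F (lcmn r x))) => x; exact: sumr_ge0.
Qed.

Lemma sum_prods_inv (K : numFieldType) N k :
  \sum_(ds <- words (iota 1 N) k) (prods ds)%:R^-1 =
    (\sum_(d <- iota 1 N) d%:R^-1) ^+ k :> K.
Proof.
elim: k => [|k IHk]; first by rewrite big_seq1 /prods big_nil invr1.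
rewrite big_words exprS -IHk big_distrl; apply: eq_bigr => d _.
rewrite big_distrr; apply: eq_bigr => ds _.
by rewrite /prods big_cons natrM invfM.
Qed.

(** * Rows of stochastic matrices *)

(** Reducing a fraction divides numerator and denominator by a common factor. *)
Lemma height_frac s r : (0 < r)%N ->
  (height (s%:R / r%:R) <= maxn s r)%N.
Proof.
move=> r0; rewrite (pmulrn _ s) (pmulrn _ r).
have : r%:Z != 0 by rewrite eqz_nat -lt0n.
rewrite -[X in maxn X _](absz_nat s) -[X in maxn _ X](absz_nat r).
case: divqP => [_|k x k0 _]; first by rewrite eqxx.
rewrite !abszM -maxnMr leq_pmull // absz_gt0 //.
Qed.

Definition fracs (N : nat) : seq rat :=
  undup [seq s%:R / r%:R | s <- iota 0 N.+1, r <- iota 1 N].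

Lemma mem_fracs N x : (x \in fracs N) = (0 <= x) && (height x <= N)%N.
Proof.
rewrite mem_undup; apply/allpairsP/andP => [[[s r] []]|[x0]].
  rewrite !mem_iota add1n add0n !ltnS => /= sN /andP[r0 rN] ->.
  split; first by rewrite divr_ge0 ?ler0n.
  by apply: leq_trans (height_frac _ r0) _; rewrite geq_max sN.
rewrite /height geq_max => /andP[nN dN].
exists (`|numq x|%N, `|denq x|%N); split.
- by rewrite mem_iota add0n ltnS.
- by rewrite mem_iota add1n ltnS absz_gt0 denq_neq0.
by rewrite -[LHS]divq_num_den /= !pmulrn !gez0_abs // numq_ge0.
Qed.

Definition stochastic_rows (N n : nat) : seq (seq rat) :=
  [seq w <- words (fracs N) n | \sum_(x <- w) x == 1].

Lemma mem_stochastic_rows N n w : (w \in stochastic_rows N n) =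
  [&& \sum_(x <- w) x == 1, size w == n &
      all (fun x => (0 <= x) && (height x <= N)%N) w].
Proof.
by rewrite mem_filter mem_words; do 2?congr andb; apply: eq_all => x; rewrite mem_fracs.
Qed.

Lemma uniq_stochastic_rows N n : uniq (stochastic_rows N n).
Proof. by rewrite filter_uniq // uniq_words // undup_uniq. Qed.

(** The rows of a stochastic matrix are independent of each other. *)
Lemma count_stochasticE (R : realType) n (H : R) : 0 <= H ->
  count_stochastic n H = (size (stochastic_rows (Num.truncn H) n) ^ n)%N.
Proof.
move=> H0; set N := Num.truncn H.
pose mx (w : seq (seq rat)) : 'M[rat]_n :=
  \matrix_(i, j) nth 0 (nth [::] w i) j.
pose ms := map mx (words (stochastic_rows N n) n).
have rowsP w : w \in words (stochastic_rows N n) n ->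
    size w = n /\ forall i : 'I_n, nth [::] w i \in stochastic_rows N n.
  rewrite mem_words => /andP[/eqP sw /allP aw]; split=> // i.
  by apply/aw/mem_nth; rewrite sw.
have sizerow v : v \in stochastic_rows N n -> size v = n.
  by rewrite mem_stochastic_rows => /and3P[_ /eqP].
have ums : uniq ms.
  rewrite map_inj_in_uniq ?uniq_words ?uniq_stochastic_rows // => v w.
  move=> /rowsP[sv hv] /rowsP[sw hw] /matrixP vw.
  apply: (@eq_from_nth _ [::]) => [|i]; first by rewrite sv.
  rewrite sv => lin; pose i' := Ordinal lin.
  have := hv i'; have := hw i'; move=> /= /sizerow swi /sizerow svi.
  apply: (@eq_from_nth _ 0) => [|j]; first by rewrite svi.
  by rewrite svi => ljn; have := vw i' (Ordinal ljn); rewrite !mxE.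
have msE : stochastic_ht n H = [set` ms].
  apply/seteqP; split=> [A [[A0 A1] AH]|A] /=.
    apply/mapP; exists [seq [seq A i j | j <- enum 'I_n] | i <- enum 'I_n].
      rewrite mem_words size_map size_enum_ord eqxx /=; apply/allP => v.
      case/mapP => i _ ->; rewrite mem_stochastic_rows size_map size_enum_ord.
      rewrite big_map big_enum /= A1 !eqxx /=; apply/allP => x /mapP[j _ ->].
      by rewrite A0 /= truncn_ge_nat.
    apply/matrixP => i j; rewrite mxE (nth_map i) ?size_enum_ord //.
    by rewrite (nth_map j) ?size_enum_ord // !nth_ord_enum.
  case/mapP => w /rowsP[sw hw] ->.
  have hA i j : (0 <= mx w i j) && (height (mx w i j) <= N)%N.
    have := hw i; rewrite mem_stochastic_rows => /and3P[_ /eqP si /allP].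
    by move=> /(_ (mx w i j)); apply; rewrite mxE mem_nth // si.
  split; [split=> [i j|i]|move=> i j].
  - by have /andP[] := hA i j.
  - have := hw i; rewrite mem_stochastic_rows => /and3P[/eqP si /eqP ni _].
    rewrite -[RHS]si (big_nth 0) ni big_mkord.
    by apply: eq_bigr => j _; rewrite mxE.
  - by have /andP[_] := hA i j; rewrite truncn_ge_nat.
rewrite /count_stochastic msE.
have -> : fset_set [set` ms] = seq_fset tt ms.
  apply/fsetP => A; rewrite in_fset_set; last exact: finite_seq.
  by rewrite seq_fsetE; apply/idP/idP; rewrite inE.
by rewrite size_seq_fset undup_id // size_map size_words.
Qed.

(** A row is determined by its denominators and numerators in lowest terms,
    which solve the congruence counted by [count_frac_sum] with [c = 1]. *)
Lemma size_stochastic_rows_le (K : numFieldType) N n :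
  (size (stochastic_rows N n))%:R <=
    (2 * N%:R) ^+ n * (\sum_(d <- iota 1 N) d%:R^-1) ^+ (2 ^ n - 1) :> K.
Proof.
pose code (w : seq rat) := ([seq `|denq x|%N | x <- w], [seq `|numq x|%N | x <- w]).
pose good rs ss := 1 - frac_sum rs ss \is a Num.int.
pose codes := [seq (rs, ss) | rs <- words (iota 1 N) n,
                 ss <- [seq ss <- words (iota 0 N.+1) n | good rs ss]].
have rowP w : w \in stochastic_rows N n ->
    {in w, forall x, x = `|numq x|%:R / `|denq x|%:R}.
  rewrite mem_stochastic_rows => /and3P[_ _ /allP w0] x /w0 /andP[x0 _].
  by rewrite -[LHS]divq_num_den /= !pmulrn !gez0_abs // numq_ge0.
have frac_code w : w \in stochastic_rows N n ->
    frac_sum (code w).1 (code w).2 = \sum_(x <- w) x.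
  move=> /rowP wP; rewrite /frac_sum /= zip_map big_map.
  by rewrite big_seq [RHS]big_seq; apply: eq_bigr => x /wP <-.
have code_inj : {in stochastic_rows N n &, injective code}.
  move=> v w /rowP vP /rowP wP [ed en].
  have svw : size v = size w by have := congr1 size ed; rewrite !size_map.
  apply: (@eq_from_nth _ 0) => // i iv.
  rewrite [LHS]vP ?mem_nth // [RHS]wP ?mem_nth -?svw //.
  rewrite -!(nth_map 0 0%N (fun x => `|numq x|%N)) -?svw // en.
  by rewrite -!(nth_map 0 0%N (fun x => `|denq x|%N)) -?svw // ed.
have code_sub : {subset map code (stochastic_rows N n) <= codes}.
  move=> _ /mapP[w wr ->].
  have frac1 := frac_code w wr.
  move: wr; rewrite mem_stochastic_rows => /and3P[/eqP w1 /eqP sw /allP wN].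
  apply/allpairsPdep; exists (code w).1, (code w).2; split=> //.
    rewrite mem_words size_map sw eqxx; apply/allP => _ /mapP[x /wN xN ->].
    move: xN; rewrite /height geq_max => /and3P[_ _ dN].
    by rewrite mem_iota add1n ltnS dN absz_gt0 denq_neq0.
  rewrite mem_filter /good frac1 w1 subrr rpred0.
  rewrite mem_words size_map sw eqxx; apply/allP => _ /mapP[x /wN xN ->].
  move: xN; rewrite /height geq_max => /and3P[_ nN _].
  by rewrite mem_iota add0n ltnS nN.
have : (size (stochastic_rows N n) <= size codes)%N.
  rewrite -(size_map code) uniq_leq_size //.
  by rewrite map_inj_in_uniq ?uniq_stochastic_rows.
rewrite size_allpairs_dep sumnE big_map -(ler_nat K) => /le_trans; apply.
apply: (@le_trans _ _ (\sum_(rs <- words (iota 1 N) n)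
   (2 * N%:R) ^+ n * (lcms rs)%:R^-1)).
  rewrite natr_sum big_seq [leRHS]big_seq; apply: ler_sum => rs.
  rewrite mem_words => /andP[/eqP srs /allP rsN].
  have rsN' : all (fun r => 0 < r <= N)%N rs.
    by apply/allP => r /rsN; rewrite mem_iota add1n ltnS.
  have L0 : (0 < lcms rs)%N.
    by apply: lcms_gt0; apply: sub_all rsN' => r /andP[].
  rewrite ler_pdivlMr ?ltr0n // -natrM -natrX -natrM ler_nat size_filter -srs.
  exact: count_frac_sum.
rewrite -big_distrr /= ler_wpM2l ?exprn_ge0 ?mulr_ge0 ?ler0n //.
apply: le_trans (sum_lcms_prods N n (F := fun x => x%:R^-1) _) _ => [x|].
  by rewrite invr_ge0 ler0n.
by rewrite sum_prods_inv.
Qed.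

(** * Primitive vectors and the lower bound *)

Definition gcds (ss : seq nat) : nat := \big[gcdn/0%N]_(s <- ss) s.

Lemma gcds_dvd ss : all (dvdn (gcds ss)) ss.
Proof.
rewrite /gcds; elim: ss => [//|s ss IHss]; rewrite big_cons /= dvdn_gcdl.
by apply: sub_all IHss => t; apply: dvdn_trans; exact: dvdn_gcdr.
Qed.

Lemma gcds_scale k ss : gcds [seq k * s | s <- ss]%N = (k * gcds ss)%N.
Proof.
rewrite /gcds big_map; elim: ss => [|s ss IHss]; first by rewrite !big_nil muln0.
by rewrite !big_cons IHss muln_gcdr.
Qed.

(** Telescoping: the tail from 3 on is dominated by
    [1 / (d - 1) - 1 / d], which adds up to less than 1/2. *)
Lemma sum_inv_sqr_le (K : realFieldType) m :
  \sum_(d <- iota 2 m) d%:R^-2 <= 3 / 4 :> K.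
Proof.
suff H k : \sum_(d <- iota 2 k.+1) d%:R^-2 <= 3 / 4 - k.+2%:R^-1 :> K.
  case: m => [|m]; first by rewrite big_nil divr_ge0 ?ler0n.
  by apply: le_trans (H m) _; rewrite gerBl invr_ge0 ler0n.
elim: k => [|k IHk]; first by rewrite big_seq1; lra.
have -> : iota 2 k.+2 = iota 2 k.+1 ++ [:: k.+3] by have := iotaD 2 k.+1 1; rewrite addn1.
rewrite big_cat big_seq1 /= -[k.+3%:R]natr1; set a : K := k.+2%:R in IHk *.
have a0 : 0 < a by rewrite ltr0n.
have a1 : 0 < a + 1 by rewrite ltr_wpDr.
have : (a + 1) ^- 2 <= a^-1 - (a + 1)^-1.
  have -> : a^-1 - (a + 1)^-1 = (a * (a + 1))^-1.
    by field; rewrite !gt_eqF.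
  by rewrite lef_pV2 ?posrE ?exprn_gt0 ?mulr_gt0 // expr2 ler_pM2r // lerDl ler01.
by move=> h; apply: le_trans (lerD IHk h) _; rewrite addrA subrK.
Qed.

Lemma count_dvdn_iota d M : count (dvdn d) (iota 1 M) = (M %/ d)%N.
Proof.
rewrite divn_count_dvd -sum1_count big_mkcond /index_iota subn1 /=.
by apply: eq_bigr => i _; case: (_ %| _)%N.
Qed.

Definition primitive (ss : seq nat) : bool := gcds ss == 1%N.

(** Union bound: the vectors divisible by [d] number [(M %/ d) ^ n], which is at
    most [M ^ n / d ^ 2], so that at most 3/4 of all vectors are not
    primitive. *)
Lemma count_primitive (K : realFieldType) M n : (2 <= n)%N ->
  M%:R ^+ n <= 4 * (count primitive (words (iota 1 M) n))%:R :> K.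
Proof.
move=> n2; set W := words _ _.
have cover : (M ^ n <= count primitive W +
    \sum_(d <- iota 2 (M - 1)) count (all (dvdn d)) W)%N.
  rewrite -{1}(size_iota 1 M) -size_words -/W -sum1_size -!sum1_count.
  under [X in (_ <= _ + X)%N]eq_bigr do rewrite -sum1_count big_mkcond.
  rewrite exchange_big [X in (_ <= X + _)%N]big_mkcond -big_split /=.
  rewrite big_seq [leqRHS]big_seq; apply: leq_sum => ss.
  rewrite mem_words => /andP[/eqP sn /allP ssM].
  rewrite /primitive; case: eqP => [_|g1]; first by rewrite leq_addr.
  have g_dvd := gcds_dvd ss; rewrite add0n.
  case: ss => [|s ss] in sn ssM g1 g_dvd *; first by rewrite -sn in n2.
  have := ssM s; rewrite mem_head mem_iota add1n ltnS => /(_ isT).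
  move=> /andP[s0 sM].
  have /andP[gs _] := g_dvd.
  have gM : (gcds (s :: ss) <= M)%N by rewrite (leq_trans _ sM) // dvdn_leq.
  have g0 : (0 < gcds (s :: ss))%N by rewrite (dvdn_gt0 s0).
  rewrite (big_rem (gcds (s :: ss))) /=; last first.
    have -> : iota 2 (M - 1) = iota 2 M.-1 by rewrite subn1.
    rewrite mem_iota addSn add1n prednK ?(leq_trans g0) // ltnS gM andbT.
    by rewrite ltn_neqAle g0 andbT eq_sym; apply/eqP.
  by rewrite gs; move: g_dvd => /= /andP[_ ->].
have divM d : (0 < d)%N -> (M %/ d)%:R ^+ n <= M%:R ^+ n * d%:R^-2 :> K.
  move=> d0; have dK : 0 < d%:R :> K by rewrite ltr0n.
  have d2 : d%:R^-n <= d%:R^-2 :> K.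
    rewrite lef_pV2 ?posrE ?exprn_gt0 // ler_weXn2l // ler1n //.
  apply: (@le_trans _ _ ((M%:R / d%:R) ^+ n)).
    rewrite lerXn2r ?nnegrE ?divr_ge0 ?ler0n // ler_pdivlMr //.
    by rewrite -natrM ler_nat leq_divM.
  by rewrite exprMn exprVn ler_wpM2l ?exprn_ge0 ?ler0n.
have : M%:R ^+ n <= (count primitive W)%:R + M%:R ^+ n * (3 / 4) :> K.
  rewrite -(ler_nat K) natrX in cover.
  apply: le_trans cover _; rewrite natrD lerD2l natr_sum.
  apply: (@le_trans _ _ (\sum_(d <- iota 2 (M - 1)) M%:R ^+ n * d%:R^-2)).
    rewrite big_seq [leRHS]big_seq; apply: ler_sum => d; rewrite mem_iota => d2.
    by rewrite count_all_words count_dvdn_iota natrX divM //; lia.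
  by rewrite -big_distrr /= ler_wpM2l ?sum_inv_sqr_le ?exprn_ge0 ?ler0n.
lra.
Qed.

(** Two primitive vectors with the same normalization are proportional; taking
    gcds in [T s = S t], where [S] and [T] are the sums of [s] and [t], gives
    [S = T], hence [s = t]. *)
Lemma size_stochastic_rows_ge N n M : (n * M <= N)%N -> (0 < n)%N ->
  (count primitive (words (iota 1 M) n) <= size (stochastic_rows N n))%N.
Proof.
move=> nMN n0.
pose row (ss : seq nat) : seq rat := [seq s%:R / (sumn ss)%:R | s <- ss].
rewrite -size_filter -(size_map row).
have sumn_gt0 ss : ss \in words (iota 1 M) n -> (0 < sumn ss)%N.
  rewrite mem_words; case: ss => [|s ss]; first by rewrite eq_sym (gtn_eqF n0).
  by rewrite /= mem_iota addn_gt0 => /andP[_ /andP[/andP[-> _]]].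
have sumn_le ss : ss \in words (iota 1 M) n -> (sumn ss <= N)%N.
  rewrite mem_words => /andP[/eqP sn sM]; apply: leq_trans nMN; rewrite -sn.
  elim: ss sM {sn} => //= s ss IHss /andP[sM /IHss ssM].
  by rewrite mulSn leq_add //; move: sM; rewrite mem_iota add1n ltnS => /andP[].
apply: uniq_leq_size.
  rewrite map_inj_in_uniq ?filter_uniq ?uniq_words ?iota_uniq // => s t.
  rewrite !mem_filter => /andP[/eqP gs sW] /andP[/eqP gt tW] st.
  have [s0 t0] := (sumn_gt0 s sW, sumn_gt0 t tW).
  have clear_den u U V : (0 < U)%N ->
      [seq (V * x)%:R | x <- u]%N =
      [seq y * (U * V)%:R | y <- [seq x%:R / U%:R | x <- u]] :> seq rat.
    move=> U0; rewrite -map_comp; apply: eq_map => x /=.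
    by rewrite !natrM mulrA divfK ?pnatr_eq0 -?lt0n // mulrC.
  have eqst : [seq sumn t * x | x <- s]%N = [seq sumn s * x | x <- t]%N.
    have natr_inj : injective (fun x : nat => x%:R : rat).
      by move=> x y /eqP; rewrite eqr_nat => /eqP.
    apply: (inj_map natr_inj); rewrite -!map_comp.
    rewrite (clear_den s (sumn s)) // (clear_den t (sumn t)) //.
    by rewrite -/(row s) -/(row t) st mulnC.
  have eqS : sumn t = sumn s.
    by have := congr1 gcds eqst; rewrite !gcds_scale gs gt !muln1.
  by move: eqst; rewrite eqS; apply: inj_map => x y /eqP; rewrite eqn_pmul2l // => /eqP.
move=> x /mapP[ss]; rewrite mem_filter => /andP[_ ssW] -> {x}.
have [ss0 ssN] := (sumn_gt0 ss ssW, sumn_le ss ssW).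
rewrite mem_stochastic_rows size_map; apply/and3P; split.
- rewrite big_map -big_distrl -natr_sum -sumnE /= divff //.
  by rewrite pnatr_eq0 -lt0n.
- by move: ssW; rewrite mem_words => /andP[].
apply/allP => _ /mapP[s ss_s ->]; rewrite divr_ge0 ?ler0n //=.
apply: leq_trans (height_frac s ss0) _; rewrite geq_max ssN andbT.
by apply: leq_trans ssN; rewrite sumnE (big_rem s) //= leq_addr.
Qed.

(** * Asymptotics *)

Lemma harmonic_le (R : realType) N : (0 < N)%N ->
  \sum_(d <- iota 1 N) d%:R^-1 <= 1 + ln N%:R :> R.
Proof.
case: N => // N _; elim: N => [|N IHN]; first by rewrite big_seq1 invr1 ln1 addr0.
have -> : iota 1 N.+2 = iota 1 N.+1 ++ [:: N.+2].
  by have := iotaD 1 N.+1 1; rewrite addn1.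
rewrite big_cat big_seq1; apply: le_trans (lerD IHN (lexx _)) _ => /=.
rewrite -addrA lerD2l -lerBrDl -lerN2 opprB.
have N0 : 0 < N.+2%:R :> R by rewrite ltr0n.
rewrite -ln_div ?posrE ?ltr0n // -[N.+1%:R](addrK 1) natr1 mulrDl divff ?gt_eqF //.
by rewrite mulN1r le_ln1Dx // ltrN2 invf_lt1 // ltr1n.
Qed.

Lemma lnln_gt (R : realType) (b : R) : \forall H \near +oo, b < ln (ln H).
Proof.
near=> H; have H1 : expR (expR b) < H by near: H; exact: nbhs_pinfty_gt (num_real _).
have lnH : expR b < ln H.
  by rewrite -[ltLHS]expRK ltr_ln ?posrE ?expR_gt0 // (lt_trans (expR_gt0 _) H1).
by rewrite -[ltLHS]expRK ltr_ln ?posrE ?expR_gt0 // (lt_trans (expR_gt0 _) lnH).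
Unshelve. all: by end_near. Qed.

Lemma cvg_div_lnln (R : realType) (c : R) : c / ln (ln H) @[H --> +oo] --> 0.
Proof.
apply/cvgrPdist_lt => eps eps0; near=> H.
rewrite sub0r normrN normrM normfV.
have lnln0 : 0 < ln (ln H) by near: H; exact: lnln_gt.
rewrite (gtr0_norm lnln0) ltr_pdivrMr // -ltr_pdivrMl //.
near: H; exact: lnln_gt.
Unshelve. all: by end_near. Qed.

Lemma count_stochastic_le (R : realType) n (H : R) : 1 <= ln H ->
  (count_stochastic n H)%:R <=
    (2 ^+ n * 2 ^+ (2 ^ n - 1)) ^+ n * H ^+ (n ^ 2) * ln H ^+ (n * (2 ^ n - 1)).
Proof.
move=> lnH1; set K := (2 ^ n - 1)%N; have H1 : 1 < H.
  by rewrite ltNge; apply/negP => /ln_le0; apply/negP; rewrite -ltNge; lra.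
have H0 : 0 <= H by lra.
have N0 : (0 < Num.truncn H)%N by rewrite truncn_gt0 ltW.
have NH : (Num.truncn H)%:R <= H by rewrite truncn_le.
have Z0 : 0 <= \sum_(d <- iota 1 (Num.truncn H)) d%:R^-1 :> R.
  by apply: sumr_ge0 => d _; rewrite invr_ge0.
have ZH : \sum_(d <- iota 1 (Num.truncn H)) d%:R^-1 <= 2 * ln H :> R.
  apply: le_trans (harmonic_le R N0) _.
  have : ln (Num.truncn H)%:R <= ln H :> R by rewrite ler_ln ?posrE ?ltr0n //; lra.
  lra.
rewrite count_stochasticE // natrX.
have -> : (2 ^+ n * 2 ^+ K) ^+ n * H ^+ (n ^ 2) * ln H ^+ (n * K) =
    ((2 * H) ^+ n * (2 * ln H) ^+ K) ^+ n.
  rewrite -mulnn (mulnC n K) !exprM -2!exprMn; congr (_ ^+ n).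
  by rewrite !exprMn; ring.
rewrite lerXn2r ?nnegrE ?mulr_ge0 ?exprn_ge0 ?mulr_ge0 //; try lra.
apply: le_trans (size_stochastic_rows_le R _ _) _.
apply: ler_pM; rewrite ?exprn_ge0 ?mulr_ge0 // lerXn2r ?nnegrE ?mulr_ge0 ?ler_wpM2l //; lra.
Qed.

(** Since [n <= H], the side [M = N %/ n] of the cube is at least [H / (2 n)]. *)
Lemma count_stochastic_ge (R : realType) n (H : R) : (2 <= n)%N -> n%:R <= H ->
  H ^+ (n ^ 2) <= (4 * (2 * n%:R) ^+ n) ^+ n * (count_stochastic n H)%:R.
Proof.
move=> n2 nH; have n0 : 0 < n%:R :> R by rewrite ltr0n; lia.
have H0 : 0 <= H by lra.
set N := Num.truncn H; pose M := (N %/ n)%N.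
have nN : (n <= N)%N by rewrite truncn_ge_nat.
have nMN : (n * M <= N)%N by rewrite mulnC leq_divM.
have HM : H <= 2 * n%:R * M%:R.
  apply: ltW; apply: lt_le_trans (truncnS_gt H) _.
  rewrite -2!natrM ler_nat -/N.
  have := ltn_ceil N (ltnW n2); have : (0 < M)%N by rewrite divn_gt0 //; lia.
  by rewrite -/M; nia.
rewrite count_stochasticE // natrX -exprMn -mulnn exprM.
rewrite lerXn2r ?nnegrE ?mulr_ge0 ?exprn_ge0 ?mulr_ge0 //; try lra.
apply: (@le_trans _ _ ((2 * n%:R * M%:R) ^+ n)).
  by rewrite lerXn2r ?nnegrE ?mulr_ge0 //; lra.
rewrite exprMn [4 * _]mulrC -mulrA ler_wpM2l ?exprn_ge0 ?mulr_ge0 //; try lra.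
apply: le_trans (count_primitive R M n2) _.
rewrite ler_wpM2l // ler_nat size_stochastic_rows_ge // ltnW //.
Qed.

Unset Implicit Arguments.

Theorem corollary2 (R : realType) (n : nat) (hn : (1 <= n)%N) :
  ((2 <= n)%N ->
     exists c : R, 0 < c /\
       \forall H \near (+oo : set_system R),
         (H : R) ^+ (n ^ 2) <= c * (count_stochastic n (H : R))%:R) /\
  (exists e : R -> R, e H @[H --> +oo] --> (0 : R) /\
     \forall H \near (+oo : set_system R),
       (count_stochastic n (H : R))%:R <=
         H ^+ (n ^ 2) * (ln H) `^ (n%:R * (2 ^+ n - 1) + e H)).
Proof.
split=> [n2|].
  exists ((4 * (2 * n%:R) ^+ n) ^+ n); split.
    by rewrite exprn_gt0 // mulr_gt0 // exprn_gt0 // mulr_gt0 // ltr0n.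
  apply: filterS (nbhs_pinfty_ge (num_real n%:R)) => H.
  exact: count_stochastic_ge.
set C : R := (2 ^+ n * 2 ^+ (2 ^ n - 1)) ^+ n.
have C0 : 0 < C by rewrite exprn_gt0 // mulr_gt0 // exprn_gt0.
exists (fun H => ln C / ln (ln H)); split; first exact: cvg_div_lnln.
apply: filterS (lnln_gt (0 : R)) => H lnln0.
have lnH1 : 1 < ln H.
  by rewrite ltNge; apply/negP => /ln_le0; rewrite leNgt lnln0.
have lnH0 : ln H != 0 by rewrite gt_eqF //; lra.
rewrite powRD ?lnH0 ?implybT //.
have -> : n%:R * (2 ^+ n - 1) = (n * (2 ^ n - 1))%:R :> R.
  by rewrite natrM natrB ?expn_gt0 // natrX.
rewrite powR_mulrn; last by lra.
(* The o(1) in the exponent is chosen to contribute exactly the constant C. *)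
have -> : ln H `^ (ln C / ln (ln H)) = C.
  by rewrite /powR (negPf lnH0) divfK ?gt_eqF // lnK.
apply: le_trans (count_stochastic_le n (ltW lnH1)) _.
by rewrite -/C [C * _]mulrC -mulrA [C * _]mulrC.
Qed.
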